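(* There exists an algorithm running in time $\mathcal{O}(|V|^8)$ that determines whether a given graph $G=(V,E)$ is a CDC split graph.
   Context: All graphs are finite, simple, undirected, with nonempty vertex set. A graph is split if its vertex set can be partitioned into a clique and an independent set. A clique is a set of pairwise adjacent vertices; it is maximal if it is not contained in a larger clique. A clique transversal of a graph is a set of vertices containing at least one vertex from each maximal clique; it is minimal if it contains no smaller clique transversal. A hypergraph is a pair $(V,E)$ with $V$ a finite set and $E$ a set of subsets of $V$ (hyperedges) such that every vertex belongs to a hyperedge; it is conformal if every set of vertices such that any two of them belong to a common hyperedge is itself contained in a hyperedge. A graph $G$ is clique dually conformal (CDC) if the hypergraph with vertex set $V(G)$ whose hyperedges are the minimal clique transversals of $G$ is conformal. *)

(* Defs.v *)
From mathcomp Require Import all_boot.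

Set Implicit Arguments.
Unset Strict Implicit.
Unset Printing Implicit Defensive.

Record graph := Graph {
  vertex :> finType;
  adj : rel vertex;
  adj_sym : symmetric adj;
  adj_irr : irreflexive adj;
  vertex_gt0 : 0 < #|vertex|
}.

Definition clique (G : graph) (K : {set G}) : bool :=
  [forall x in K, forall y in K, (x != y) ==> adj x y].

Definition independent (G : graph) (S : {set G}) : bool :=
  [forall x in S, forall y in S, ~~ adj x y].

Definition is_split (G : graph) : bool :=
  [exists K : {set G}, clique K && independent (~: K)].

Definition maximal_clique (G : graph) (K : {set G}) : bool :=
  maxset (@clique G) K.

Definition clique_transversal (G : graph) (S : {set G}) : bool :=
  [forall K : {set G}, maximal_clique K ==> (S :&: K != set0)].

Definition minimal_clique_transversal (G : graph) (S : {set G}) : bool :=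
  minset (@clique_transversal G) S.

Record hypergraph (V : finType) := Hypergraph {
  hyperedges : {set {set V}};
  hypergraph_cover : cover hyperedges = [set: V]
}.

Definition conformal (V : finType) (H : hypergraph V) : bool :=
  [forall U : {set V},
    [forall x in U, forall y in U,
       (x != y) ==> [exists e in hyperedges H, (x \in e) && (y \in e)]] ==>
    [exists e in hyperedges H, U \subset e]].

(* For v in a maximal clique K, the set v |: ~: K is a clique transversal, and
   every clique transversal inside it meets K only in v. *)
Lemma minimal_clique_transversal_cover (G : graph) :
  cover [set S : {set G} | minimal_clique_transversal S] = [set: G].
Proof.
apply/setP=> v; rewrite inE; apply/bigcupP.
have cl1 : clique [set v].
  apply/forall_inP=> x /set1P->; apply/forall_inP=> y /set1P->.
  by rewrite eqxx.
have [K maxK] := maxset_exists cl1; rewrite sub1set => vK.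
have tr : clique_transversal (v |: ~: K).
  apply/forallP=> L; apply/implyP=> maxL; apply/set0Pn.
  have [LK|/subsetPn[x xL xK]] := boolP (L \subset K).
    exists v; rewrite !inE eqxx /=.
    by case/maxsetP: maxL => _ /(_ K (maxsetp maxK) LK) <-.
  by exists x; rewrite !inE xL xK orbT.
have [S minS sS] := minset_exists tr; exists S; first by rewrite inE.
have /forallP/(_ K)/implyP/(_ maxK)/set0Pn[x] := minsetp minS.
rewrite inE => /andP[xS xK].
by move/subsetP/(_ x xS): sS; rewrite !inE xK orbF => /eqP<-.
Qed.

Definition clique_transversal_hypergraph (G : graph) : hypergraph G :=
  Hypergraph (minimal_clique_transversal_cover G).

Definition is_CDC (G : graph) : bool :=
  conformal (clique_transversal_hypergraph G).

(* Structured programs for a unit-cost random access machine. Each elementary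
   instruction and each branch test costs 1. There is no multiplication: with
   it, the unit-cost measure would be unrealistic. *)
Inductive program : Type :=
  | Skip
  | Const (r c : nat)             (* R[r] := c *)
  | Add (r s t : nat)             (* R[r] := R[s] + R[t] *)
  | Sub (r s t : nat)             (* R[r] := R[s] - R[t], truncated at 0 *)
  | Read (r s : nat)              (* R[r] := M[R[s]] *)
  | Write (r s : nat)             (* M[R[r]] := R[s] *)
  | Seq (p q : program)
  | If (r : nat) (p q : program)  (* p if R[r] <> 0, q otherwise *)
  | While (r : nat) (p : program) (* repeat p as long as R[r] <> 0 *).

(* A program names only finitely many registers; unbounded data lives in the
   indirectly addressed memory. *)
Record state := State { reg : nat -> nat; mem : nat -> nat }.

Definition update (f : nat -> nat) (a b : nat) : nat -> nat :=
  fun x => if x == a then b else f x.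

Definition set_reg (s : state) (r b : nat) : state :=
  State (update (reg s) r b) (mem s).

Definition set_mem (s : state) (a b : nat) : state :=
  State (reg s) (update (mem s) a b).

(* exec p s k s' : started in s, p halts in s' after exactly k steps. *)
Inductive exec : program -> state -> nat -> state -> Prop :=
  | exec_Skip s : exec Skip s 1 s
  | exec_Const r c s : exec (Const r c) s 1 (set_reg s r c)
  | exec_Add r a b s : exec (Add r a b) s 1 (set_reg s r (reg s a + reg s b))
  | exec_Sub r a b s : exec (Sub r a b) s 1 (set_reg s r (reg s a - reg s b))
  | exec_Read r a s : exec (Read r a) s 1 (set_reg s r (mem s (reg s a)))
  | exec_Write r a s : exec (Write r a) s 1 (set_mem s (reg s r) (reg s a))
  | exec_Seq p q s s1 s2 k1 k2 :
      exec p s k1 s1 -> exec q s1 k2 s2 -> exec (Seq p q) s (k1 + k2) s2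
  | exec_IfT r p q s k s' :
      reg s r != 0 -> exec p s k s' -> exec (If r p q) s k.+1 s'
  | exec_IfF r p q s k s' :
      reg s r = 0 -> exec q s k s' -> exec (If r p q) s k.+1 s'
  | exec_WhileT r p s s1 s2 k1 k2 :
      reg s r != 0 -> exec p s k1 s1 -> exec (While r p) s1 k2 s2 ->
      exec (While r p) s (k1 + k2).+1 s2
  | exec_WhileF r p s : reg s r = 0 -> exec (While r p) s 1 s.

(* The input: n = |V| in register 0 and, from address 0 on, the adjacency
   matrix in row-major order with respect to an enumeration v of the vertices;
   every other register and memory cell is 0. *)
Definition input (G : graph) (v : 'I_#|G| -> G) : state :=
  State (fun r => if r == 0 then #|G| else 0)
        (fun a => [exists i : 'I_#|G|, exists j : 'I_#|G|,
                     (a == i * #|G| + j) && adj (v i) (v j)]).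

(* The answer is read off register 0, as 1 for yes and 0 for no. *)
Definition decides_in_time (p : program) (P : pred graph) (t : nat -> nat) :
    Prop :=
  forall (G : graph) (v : 'I_#|G| -> G), bijective v ->
  exists (k : nat) (s : state),
    [/\ exec p (input v) k s, k <= t #|G| & reg s 0 = P G :> nat].

Definition bigO (t g : nat -> nat) : Prop :=
  exists c n0 : nat, forall n : nat, n0 <= n -> t n <= c * g n.

(* Main.v *)
Require Import Defs.
From mathcomp Require Import all_boot zify.

Set Implicit Arguments.
Unset Strict Implicit.
Unset Printing Implicit Defensive.

(** Deciding whether a graph is a CDC split graph.

    Let K be a maximal clique of a graph whose complement is independent. The
    maximal cliques are K and the closed neighbourhoods of the vertices outside
    K ([maximal_clique_split]), so a minimal clique transversal is determined by
    its trace A on K: it consists of A and of the vertices outside K that have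
    no neighbour in A. The traces that occur are the nonempty irredundant sets,
    those in which each a has a private neighbour outside K unless A = {a}
    ([completion_minimal], [minimal_transversal_split]). This determines which
    pairs of vertices lie in a common minimal transversal, and conformality
    splits into two conditions ([is_CDC_split]):
    - sets of pairwise incomparable vertices of K are irredundant. It is enough
      to compare each a with all vertices incomparable to it at once: if these
      dominate every outer neighbour of a, a minimal choice of them that still
      does is an antichain, and together with a it violates the condition;
    - the sets of non-neighbours in K of the outer vertices have the Helly
      property, which the criterion of Berge and Duchet reduces to triples of
      vertices of K.

    The clique K need not be searched for: in every split graph it can be taken
    to be either the closed neighbourhood of a vertex or the set of all
    nonsimplicial vertices ([split_definable_clique]). Hence the CDC split
    graphs are axiomatized by one first-order sentence over the adjacency
    relation ([eval_CDC_split]), in which seven quantifiers are nested.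

    A first-order sentence is evaluated on the machine by one loop per
    quantifier ([compile_computes]), in time O(n ^ d) for nesting depth d. *)

(** * Clique transversals of a split graph *)

Definition closed_nbhd (G : graph) (v : G) : {set G} :=
  [set x | (x == v) || adj v x].

Section SplitGraph.

Variables (G : graph) (K : {set G}).

(** Incomparability of the neighbourhoods outside [K]. *)
Definition incomparable (a b : G) : bool :=
  [exists w, (w \notin K) && (adj a w && ~~ adj b w)] &&
  [exists w, (w \notin K) && (adj b w && ~~ adj a w)].

Definition split_partition : bool := clique K && independent (~: K).

Definition inextensible : bool :=
  [forall v, (v \notin K) ==> [exists a in K, ~~ adj a v]].

(** The antichain condition. The premise on [b] exempts the vertices comparable
    to all others, which may have no neighbour outside [K] at all. *)
Definition private_neighbours : bool :=
  [forall a in K, forall b in K, incomparable a b ==>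
    [exists v, (v \notin K) && (adj a v &&
       [forall b' in K, incomparable a b' ==> ~~ adj b' v])]].

(** Some two of the positions [a], [b], [c] hold non-neighbours of [v]; the
    three vertices may coincide. *)
Definition misses_two (a b c v : G) : bool :=
  [|| ~~ adj a v && ~~ adj b v, ~~ adj a v && ~~ adj c v
    | ~~ adj b v && ~~ adj c v].

(** The Berge-Duchet criterion for the sets of vertices of [K] that are not
    adjacent to a given vertex outside [K]. *)
Definition helly_triples : bool :=
  [forall a in K, forall b in K, forall c in K,
    [exists d in K,
      [forall v, (v \notin K) ==> (misses_two a b c v ==> ~~ adj d v)]]].

Hypotheses (splitK : split_partition) (maxK : inextensible).

Lemma cliqueK : clique K. Proof. by case/andP: splitK. Qed.

Lemma adjK x y : x \in K -> y \in K -> x != y -> adj x y.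
Proof.
by move=> xK yK; have /forall_inP/(_ x xK)/forall_inP/(_ y yK)/implyP := cliqueK.
Qed.

Lemma adj_outside x y : x \notin K -> adj x y -> y \in K.
Proof.
move=> xK; apply: contraTT => yK; case/andP: splitK => _ /forall_inP/(_ x).
by rewrite inE => /(_ xK)/forall_inP; apply; rewrite inE.
Qed.

Lemma maximal_cliqueK : maximal_clique K.
Proof.
apply/maxsetP; split=> [|L cL KL]; first exact: cliqueK.
apply/eqP; rewrite eqEsubset KL andbT; apply/subsetP=> v vL.
apply: contraT => vK; move/forallP/(_ v)/implyP/(_ vK)/exists_inP: maxK => [a aK].
suff -> : adj a v by [].
have /forall_inP/(_ a (subsetP KL _ aK))/forall_inP/(_ v vL)/implyP := cL.
by apply; apply: contraNneq vK => <-.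
Qed.

Lemma maximal_clique_star v :
  v \notin K -> maximal_clique (closed_nbhd v).
Proof.
move=> vK; apply/maxsetP; split.
  apply/forall_inP=> x; rewrite inE => xv; apply/forall_inP=> y; rewrite inE => yv.
  apply/implyP=> xy; case/predU1P: xv yv xy => [->|vx] /predU1P[->|vy] xy //.
  - by rewrite eqxx in xy.
  - by rewrite adj_sym.
  - by apply: adjK => //; apply: adj_outside vK _.
move=> L cL sL; apply/eqP; rewrite eqEsubset sL andbT; apply/subsetP=> x xL.
rewrite inE; have [//|xv] := eqVneq x v.
have vL : v \in L by apply: (subsetP sL); rewrite inE eqxx.
have /forall_inP/(_ v vL)/forall_inP/(_ x xL)/implyP-> // := cL.
by rewrite eq_sym.
Qed.

(** A clique other than [K] contains some [v] outside [K], and all its other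
    vertices are neighbours of [v]. *)
Lemma maximal_clique_split L : maximal_clique L ->
  L = K \/ exists2 v, v \notin K & L = closed_nbhd v.
Proof.
move=> mL; have cL : clique L := maxsetp mL.
have [LK|/subsetPn[v vL vK]] := boolP (L \subset K).
  by left; case/maxsetP: mL => _ /(_ K cliqueK LK).
right; exists v => //; apply/esym; case/maxsetP: mL => _; apply.
  exact: maxsetp (maximal_clique_star vK).
apply/subsetP=> x xL; rewrite inE; have [//|xv] := eqVneq x v.
have /forall_inP/(_ v vL)/forall_inP/(_ x xL)/implyP-> // := cL.
by rewrite eq_sym.
Qed.

Definition hits (S : {set G}) (v : G) : bool := [exists x in S, (x == v) || adj v x].

Lemma transversalP (S : {set G}) :
  reflect ((exists2 a, a \in S & a \in K) /\ forall v, v \notin K -> hits S v)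
          (clique_transversal S).
Proof.
apply: (iffP forallP) => [tS|[[a aS aK] hS] L]; first split.
- have /implyP/(_ maximal_cliqueK)/set0Pn[a] := tS K.
  by rewrite inE => /andP[]; exists a.
- move=> v vK.
  have /implyP/(_ (maximal_clique_star vK))/set0Pn[x] := tS (closed_nbhd v).
  by rewrite !inE => xS; apply/existsP; exists x.
apply/implyP=> /maximal_clique_split[->|[v vK ->]]; apply/set0Pn.
  by exists a; rewrite inE aS.
by have /exists_inP[x xS xv] := hS v vK; exists x; rewrite !inE xS.
Qed.

(** Supersets of clique transversals are clique transversals, so minimality only
    has to be tested by removing single vertices. *)
Lemma minimal_transversalP (S : {set G}) :
  reflect (clique_transversal S /\
           forall x, x \in S -> ~~ clique_transversal (S :\ x))
          (minimal_clique_transversal S).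
Proof.
have mono (A B : {set G}) :
    A \subset B -> clique_transversal A -> clique_transversal B.
  move=> AB /forallP tA; apply/forallP=> L; apply/implyP=> mL.
  have /implyP/(_ mL)/set0Pn[x] := tA L; rewrite inE => /andP[xA xL].
  by apply/set0Pn; exists x; rewrite inE (subsetP AB) ?xL.
apply: (iffP minsetP) => [[tS mS]|[tS mS]]; split=> //.
  move=> x xS; apply/negP=> tSx; move: (mS _ tSx (subD1set _ _)) => Sx.
  by move: xS; rewrite -Sx !inE eqxx.
move=> B tB BS; apply/eqP; rewrite eqEsubset BS; apply/subsetP=> x xS.
apply: contraTT tB => xB; apply: contra (mS x xS); apply: mono.
by rewrite subsetD1 BS.
Qed.

(** For A = {a}, the vertex [a] is indispensable because of the clique [K];
    otherwise it needs a clique outside. *)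
Definition irredundant (A : {set G}) : Prop :=
  forall a, a \in A -> A = [set a] \/
    exists v, [/\ v \notin K, adj a v & forall b, b \in A -> b != a -> ~~ adj b v].

Definition completion (A : {set G}) : {set G} :=
  A :|: [set v | (v \notin K) && [forall b in A, ~~ adj b v]].

(** The added vertices are indispensable because nothing else meets their closed
    neighbourhoods, and those of [A] by irredundance. *)
Lemma completion_minimal (A : {set G}) :
    A \subset K -> A != set0 -> irredundant A ->
  minimal_clique_transversal (completion A).
Proof.
move=> AK /set0Pn[a0 a0A] irr.
have inT x : x \in completion A = (x \in A) || ((x \notin K) && [forall b in A, ~~ adj b x]).
  by rewrite !inE.
apply/minimal_transversalP; split.
  apply/transversalP; split.
    by exists a0; [rewrite inT a0A | exact: (subsetP AK)].
  move=> v vK; have [nb|/forall_inPn[b bA]] := boolP [forall b in A, ~~ adj b v].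
    by apply/exists_inP; exists v; rewrite ?eqxx // inT vK nb orbT.
  rewrite negbK => bv; apply/exists_inP; exists b; first by rewrite inT bA.
  by rewrite adj_sym bv orbT.
move=> x; rewrite inT => /orP[xA|/andP[xK /forall_inP nb]]; apply/negP;
  case/transversalP=> [[a]]; rewrite !inE => /andP[ax].
  have [A1|[v [vK av pv]]] := irr x xA; last first.
    move=> _ _ /(_ v vK)/exists_inP[y]; rewrite !inE => /andP[yx yA].
    case/predU1P=> [yv|vy].
      move: yA; rewrite yv (negbTE vK) /=; case/orP=> [vA|/forall_inP/(_ x xA)].
        by rewrite (subsetP AK) in vK.
      by rewrite av.
    move: yA; rewrite (adj_outside vK vy) /= orbF => yA.
    by have := pv y yA yx; rewrite adj_sym vy.
  by rewrite A1 !inE (negbTE ax) /= => /andP[/negbTE->].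
move=> _ _ /(_ x xK)/exists_inP[y]; rewrite !inE => /andP[yx yA].
rewrite (negbTE yx) /= => xy; move: yA; rewrite (adj_outside xK xy) /= orbF.
by move/nb; rewrite adj_sym xy.
Qed.

(** Removing [a] from [S] leaves [K] or some closed neighbourhood unmet, which
    gives the two cases of irredundance. A vertex outside [K] is in [S] only to
    meet its own closed neighbourhood, so no neighbour of it is in [S]. *)
Lemma minimal_transversal_split (S : {set G}) : minimal_clique_transversal S ->
  [/\ S :&: K != set0, irredundant (S :&: K)
    & forall a v, a \in S :&: K -> v \in S -> v \notin K -> ~~ adj a v].
Proof.
case/minimal_transversalP=> /transversalP[[a0 a0S a0K] hS] mS.
split; first by apply/set0Pn; exists a0; rewrite inE a0S.
  move=> a; rewrite inE => /andP[aS aK].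
  have [S1|/eqP neqS] := eqVneq (S :&: K) [set a]; [by left | right].
  have /existsP[v /andP[vK nh]] : [exists v, (v \notin K) && ~~ hits (S :\ a) v].
    apply: contraR (mS a aS); rewrite negb_exists => /forallP h.
    apply/transversalP; split; last first.
      by move=> v vK; have := h v; rewrite vK negbK.
    have [/exists_inP[b bS bK]|] := boolP [exists b in S :\ a, b \in K].
      by exists b.
    rewrite negb_exists_in => /forall_inP nb; case: neqS; apply/setP=> x.
    rewrite !inE; apply/andP/eqP=> [[xS xK]|->] //.
    by apply: contraTeq xK => xa; apply: nb; rewrite !inE xa.
  rewrite negb_exists_in in nh; move/forall_inP: nh => nh; exists v.
  have ns x : x \in S -> x != a -> ~~ ((x == v) || adj v x).
    by move=> xS xa; apply: nh; rewrite !inE xa.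
  split=> //.
    have /exists_inP[x xS xv] := hS v vK.
    have xa : x = a by apply: contraTeq xv; apply: ns.
    case/predU1P: xv => [xv|]; last by rewrite xa adj_sym.
    by rewrite -xv xa aK in vK.
  move=> b; rewrite inE => /andP[bS bK] ba; have := ns b bS ba.
  by rewrite negb_or adj_sym => /andP[].
move=> a v; rewrite inE => /andP[aS aK] vS vK; apply: contra (mS v vS) => av.
have av' : a != v by apply: contraNneq vK => <-.
apply/transversalP; split; first by exists a; rewrite // !inE av'.
move=> u uK; have [->|uv] := eqVneq u v.
  by apply/exists_inP; exists a; rewrite ?inE ?av' // adj_sym av orbT.
have /exists_inP[x xS xu] := hS u uK; apply/exists_inP; exists x => //.
rewrite !inE xS andbT; apply: contraTneq xu => ->; rewrite eq_sym (negbTE uv) /=.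
by apply: contra vK; apply: adj_outside.
Qed.

Definition co_occur (x y : G) : bool :=
  [exists S in hyperedges (clique_transversal_hypergraph G),
     (x \in S) && (y \in S)].

Lemma co_occurP x y :
  reflect (exists S : {set G}, [/\ minimal_clique_transversal S, x \in S & y \in S])
          (co_occur x y).
Proof.
apply: (iffP exists_inP) => [[S]|[S [mS xS yS]]].
  by rewrite inE => mS /andP[]; exists S.
by exists S; rewrite ?inE // xS.
Qed.

Lemma is_CDCP :
  reflect (forall U : {set G},
     (forall x y, x \in U -> y \in U -> x != y -> co_occur x y) ->
     exists2 S : {set G}, minimal_clique_transversal S & U \subset S)
   (is_CDC G).
Proof.
apply: (iffP forallP) => [cdc U co|cdc U].
  have /implyP/(_ _)/exists_inP[] := cdc U.
    by do 2!apply/forall_inP => ? ?; apply/implyP; apply: co.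
  by move=> S; rewrite inE => mS US; exists S.
apply/implyP=> /forall_inP co; have [x y xU yU xy|S mS US] := cdc U.
  by move/forall_inP/(_ y yU)/implyP: (co x xU); apply.
by apply/exists_inP; exists S; rewrite ?inE.
Qed.

Lemma irredundant1 a : irredundant [set a].
Proof. by move=> b /set1P->; left. Qed.

Lemma completion1 a : a \in K -> minimal_clique_transversal (completion [set a]).
Proof.
move=> aK; apply: completion_minimal; last exact: irredundant1.
  by rewrite sub1set.
by apply/set0Pn; exists a; rewrite inE.
Qed.

Lemma co_occur_outside v w : v \notin K -> w \notin K ->
  reflect (exists2 d, d \in K & ~~ adj d v && ~~ adj d w) (co_occur v w).
Proof.
move=> vK wK; apply: (iffP (co_occurP _ _)) => [[S [mS vS wS]]|[d dK /andP[dv dw]]].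
  have [/set0Pn[d dSK] _ ne] := minimal_transversal_split mS.
  by exists d; [case/setIP: dSK | rewrite !ne].
exists (completion [set d]); split; first exact: completion1.
  by rewrite !inE vK; apply/orP; right; apply/forall_inP=> b /set1P->.
by rewrite !inE wK; apply/orP; right; apply/forall_inP=> b /set1P->.
Qed.

Lemma co_occur_incomparable a b : a \in K -> b \in K -> a != b ->
  co_occur a b = incomparable a b.
Proof.
move=> aK bK ab; apply/co_occurP/idP => [[S [mS aS bS]]|/andP[]].
  have [_ irr _] := minimal_transversal_split mS.
  have priv x y : x \in S -> y \in S -> x \in K -> y \in K -> x != y ->
      [exists w, (w \notin K) && (adj x w && ~~ adj y w)].
    move=> xS yS xK yK xy; have [|S1|[w [wK xw nw]]] := irr x.
    - by rewrite inE xS.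
    - have : y \in S :&: K by rewrite inE yS.
      by rewrite S1 inE eq_sym (negbTE xy).
    by apply/existsP; exists w; rewrite wK xw nw ?inE ?yS // eq_sym.
  by rewrite /incomparable !priv // eq_sym.
case/existsP=> v /and3P[vK av bv] /existsP[w /and3P[wK bw aw]].
exists (completion [set a; b]); split; rewrite ?inE ?eqxx ?orbT //.
apply: completion_minimal.
- by apply/subsetP=> x /set2P[]->.
- by apply/set0Pn; exists a; rewrite !inE eqxx.
move=> x /set2P[]->; right; [exists v | exists w]; split=> // y /set2P[]->//;
  by rewrite eqxx.
Qed.

(** If the vertices incomparable to [a] dominate all neighbours of [a] outside
    [K], a minimal dominating choice [A] of them is an antichain: were one
    member below another, it could be dropped. Then [a |: A] has its pairs in
    common minimal transversals, but [a] has no private neighbour in it. *)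
Lemma CDC_private_neighbours : is_CDC G -> private_neighbours.
Proof.
move/is_CDCP=> cdc; apply/forall_inP=> a aK; apply/forall_inP=> b0 b0K.
apply/implyP=> ab0; apply: contraT; rewrite negb_exists => /forallP cov.
pose B := [set b in K | incomparable a b].
(* no proper subset of a minimal [A] with this property dominates the
   neighbours of [a] outside [K] *)
pose covers (A : {set G}) := (A \subset B) &&
  [forall v, (v \notin K) ==> adj a v ==> [exists b in A, adj b v]].
have covB : covers B.
  rewrite /covers subxx; apply/forallP=> v; apply/implyP=> vK; apply/implyP=> av.
  have := cov v; rewrite vK av /= => /forall_inPn[b bK].
  by rewrite negb_imply negbK => /andP[ib bv]; apply/exists_inP; exists b; rewrite ?inE ?bK.
have [A /minsetP[/andP[AB /forallP covA] minA] _] := minset_exists covB.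
have Ainc b : b \in A -> b \in K /\ incomparable a b.
  by move/(subsetP AB); rewrite inE => /andP[].
have ana b : b \in A -> b != a.
  move/Ainc=> [_]; apply: contraTneq => ->; apply/negP=> /andP[/existsP[w]].
  by rewrite andbN andbF.
have aux b b' : b \in A -> b' \in A -> b != b' ->
    [exists w, (w \notin K) && (adj b w && ~~ adj b' w)].
  move=> bA b'A bb'; apply: contraT; rewrite negb_exists => /forallP le.
  have : A :\ b = A.
    apply: minA; last exact: subD1set.
    rewrite /covers (subset_trans (subD1set _ _) AB); apply/forallP=> v.
    apply/implyP=> vK; apply/implyP=> av.
    have := covA v; rewrite vK av /= => /exists_inP[c cA cv].
    apply/exists_inP; have [cb|cb] := eqVneq c b.
      exists b'; first by rewrite !inE eq_sym bb'.
      by have := le v; rewrite vK -cb cv /= negbK.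
    by exists c; rewrite // !inE cb.
  by move/setP/(_ b); rewrite !inE eqxx bA.
have inc_sym x y : incomparable x y = incomparable y x by rewrite /incomparable andbC.
have [x y|S mS aAS] := cdc (a |: A).
  have inKA z : z \in a |: A -> z \in K by case/setU1P=> [->|/Ainc[]].
  move=> xU yU xy; rewrite co_occur_incomparable ?inKA //.
  case/setU1P: xU yU xy => [->|xA] /setU1P[->|yA] xy.
  - by rewrite eqxx in xy.
  - by case: (Ainc y yA).
  - by rewrite inc_sym; case: (Ainc x xA).
  by rewrite /incomparable !aux // eq_sym.
have [_ irr _] := minimal_transversal_split mS.
have AS b : b \in A -> b \in S :&: K.
  by move=> bA; rewrite inE (subsetP aAS) ?setU1r //; case: (Ainc b bA).
have aS : a \in S :&: K by rewrite inE (subsetP aAS) ?setU11.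
have [S1|[v [vK av nv]]] := irr a aS.
  case/andP: ab0 => /existsP[v /and3P[vK av _]] _.
  have := covA v; rewrite vK av /= => /exists_inP[b bA _].
  by have := AS b bA; rewrite S1 inE (negbTE (ana b bA)).
have := covA v; rewrite vK av /= => /exists_inP[b bA bv].
by have := nv b (AS b bA) (ana b bA); rewrite bv.
Qed.

(** Two outer vertices that both miss two of the three positions miss a common
    one, so such vertices lie pairwise in common minimal transversals. A
    minimal transversal through all of them meets [K] in the required [d]. *)
Lemma CDC_helly_triples : is_CDC G -> helly_triples.
Proof.
move/is_CDCP=> cdc; apply/forall_inP=> a aK; apply/forall_inP=> b bK.
apply/forall_inP=> c cK.
have [v w|S mS /subsetP US] := cdc [set v | (v \notin K) && misses_two a b c v].
  rewrite !inE => /andP[vK v2] /andP[wK w2] _; apply/co_occur_outside=> //.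
  move: v2 w2; rewrite /misses_two.
  case av: (adj a v) => /=; case bv: (adj b v) => //=;
  case cv: (adj c v) => //=; case aw: (adj a w) => /=;
  case bw: (adj b w) => //=; case cw: (adj c w) => //= _ _;
  by first [exists a; by rewrite ?av ?aw | exists b; by rewrite ?bv ?bw
           |exists c; by rewrite ?cv ?cw].
have [/set0Pn[d dSK] _ ne] := minimal_transversal_split mS.
apply/exists_inP; exists d; first by case/setIP: dSK.
apply/forallP=> v; apply/implyP=> vK; apply/implyP=> v2.
by apply: ne => //; apply: US; rewrite inE vK.
Qed.

(** Induction on [U]: remove each of three vertices of [U] in turn; of the three
    vertices of [K] obtained for the rest, every member of [U] misses two. *)
Lemma helly_outside (U : {set G}) : helly_triples ->
    (forall v, v \in U -> v \notin K) ->
    (forall v w, v \in U -> w \in U -> v != w -> co_occur v w) ->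
  exists2 d, d \in K & forall v, v \in U -> ~~ adj d v.
Proof.
move=> /forall_inP helly; elim: {U}_.+1 {-2}U (ltnSn #|U|) => // m IHm U Um UK co.
have pair v w : v \in U -> w \in U -> exists2 d, d \in K & ~~ adj d v && ~~ adj d w.
  move=> vU wU; have [<-|vw] := eqVneq v w.
    have /forallP/(_ v)/implyP/(_ (UK v vU))/exists_inP[d dK dv] := maxK.
    by exists d; rewrite // dv.
  by apply/co_occur_outside; rewrite ?UK ?co.
have [->|[v1 v1U]] := set_0Vmem U.
  have /card_gt0P[x _] := vertex_gt0 G.
  have [xK|xK] := boolP (x \in K); first by exists x => // v; rewrite inE.
  have /forallP/(_ x)/implyP/(_ xK)/exists_inP[d dK _] := maxK.
  by exists d => // v; rewrite inE.
have [U1|[v2 v2U]] := set_0Vmem (U :\ v1).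
  have [d dK /andP[dv _]] := pair v1 v1 v1U v1U; exists d => // v vU.
  suff -> : v = v1 by [].
  by apply: contra_eq U1 => vv1; apply/set0Pn; exists v; rewrite !inE vv1.
have [U2|[v3 v3U]] := set_0Vmem (U :\ v1 :\ v2).
  have v2U' : v2 \in U by case/setD1P: v2U.
  have [d dK /andP[dv dw]] := pair v1 v2 v1U v2U'; exists d => // v vU.
  have [->//|v_1] := eqVneq v v1; suff -> : v = v2 by [].
  apply: contra_eq U2 => v_2; apply/set0Pn.
  by exists v; rewrite !inE v_2 v_1.
move: v2U v3U; rewrite !inE => /andP[v21 v2U] /and3P[v32 v31 v3U].
have sub x : x \in U -> exists2 d, d \in K & forall v, v \in U -> v != x -> ~~ adj d v.
  move=> xU; have [|v|v w|d dK dn] := IHm (U :\ x).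
  - by move: Um; rewrite (cardsD1 x) xU.
  - by rewrite inE => /andP[_ /UK].
  - by rewrite !inE => /andP[_ vU] /andP[_ wU]; apply: co.
  by exists d => // v vU vx; apply: dn; rewrite !inE vx.
have [a aK na] := sub v1 v1U; have [b bK nb] := sub v2 v2U.
have [c cK nc] := sub v3 v3U.
have /forall_inP/(_ b bK)/forall_inP/(_ c cK)/exists_inP[d dK /forallP nd] := helly a aK.
exists d => // v vU; have /implyP/(_ (UK v vU))/implyP := nd v; apply.
rewrite /misses_two; have [->|v_1] := eqVneq v v1.
  by rewrite (nb v1) 1?eq_sym // (nc v1) 1?eq_sym // !orbT.
have [->|v_2] := eqVneq v v2.
  by rewrite (na v2) // (nc v2) 1?eq_sym // !orbT.
by rewrite na ?nb.
Qed.

(** If [U] meets [K], its trace is an antichain, hence irredundant, and its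
    completion contains [U]. Otherwise [U] lies in the completion of a single
    vertex given by the Helly property. *)
Lemma CDC_sufficient : private_neighbours -> helly_triples -> is_CDC G.
Proof.
move=> /forall_inP priv helly; apply/is_CDCP=> U co.
have [U0|[a0 a0A]] := set_0Vmem (U :&: K).
  have UK v : v \in U -> v \notin K.
    by move=> vU; apply: contra_eqN U0 => vK; apply/set0Pn; exists v; rewrite inE vU.
  have [d dK nd] := helly_outside helly UK co.
  exists (completion [set d]); first exact: completion1.
  apply/subsetP=> v vU; rewrite !inE UK //; apply/orP; right.
  by apply/forall_inP=> b /set1P->; apply: nd.
exists (completion (U :&: K)); last first.
  apply/subsetP=> v vU; rewrite !inE vU /=; have [//|vK /=] := boolP (v \in K).
  apply/forall_inP=> a /setIP[aU aK].
  have /co_occurP[S [mS aS vS]] : co_occur a v.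
    by apply: co => //; apply: contraNneq vK => <-.
  by have [_ _ ne] := minimal_transversal_split mS; apply: ne; rewrite // inE aS.
apply: completion_minimal; first exact: subsetIr.
  by apply/set0Pn; exists a0.
move=> a aA; have [->|Aa] := eqVneq (U :&: K) [set a]; [by left | right].
case/setIP: (aA) => aU aK.
have inc b : b \in U :&: K -> b != a -> incomparable a b.
  by case/setIP=> bU bK ba; rewrite -co_occur_incomparable 1?eq_sym // co // eq_sym.
have /exists_inP[b bA ba] : [exists b in U :&: K, b != a].
  apply: contraR Aa; rewrite negb_exists_in => /forall_inP eqa.
  rewrite eqEsubset sub1set aA andbT; apply/subsetP=> b bA.
  by rewrite inE -[_ == _]negbK eqa.
have bK : b \in K by case/setIP: bA.
have /forall_inP/(_ b bK)/implyP/(_ (inc b bA ba)) := priv a aK.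
case/existsP=> v /and3P[vK av /forall_inP nv]; exists v; split=> // b' b'A b'a.
have b'K : b' \in K by case/setIP: b'A.
by have /implyP/(_ (inc b' b'A b'a)) := nv b' b'K.
Qed.

Lemma is_CDC_split : is_CDC G = private_neighbours && helly_triples.
Proof.
apply/idP/andP=> [cdc|[]]; last exact: CDC_sufficient.
by split; [exact: CDC_private_neighbours | exact: CDC_helly_triples].
Qed.

End SplitGraph.

(** * Locating the clique *)

Definition nonsimplicial (G : graph) : {set G} :=
  [set x | [exists y, exists z, [&& adj x y, adj x z, y != z & ~~ adj y z]]].

Definition CDC_split_at (G : graph) (K : {set G}) : bool :=
  [&& split_partition K, inextensible K, private_neighbours K & helly_triples K].

(** Take a maximal clique [K] with independent complement. All vertices outside
    [K] are simplicial, having neighbours only in [K]. If no vertex of [K] is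
    simplicial, [K] is the set of nonsimplicial vertices; if [x] in [K] is, its
    closed neighbourhood is a clique that contains [K]. *)
Lemma split_definable_clique (G : graph) : is_split G -> exists K : {set G},
  [/\ split_partition K, inextensible K
    & K = nonsimplicial G \/ exists v, K = closed_nbhd v].
Proof.
case/existsP=> K0 /andP[cK0 /forall_inP iK0].
have [K maxK K0K] := maxset_exists cK0.
have cK : clique K := maxsetp maxK.
have sK : split_partition K.
  rewrite /split_partition cK; apply/forall_inP=> x xK; apply/forall_inP=> y yK.
  have sC : ~: K \subset ~: K0 by rewrite setCS.
  by have /forall_inP/(_ y (subsetP sC y yK)) := iK0 x (subsetP sC x xK).
exists K; split=> //.
  apply/forallP=> v; apply/implyP=> vK; apply: contraR (vK).
  rewrite negb_exists_in => /forall_inP av; suff <- : v |: K = K by rewrite setU11.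
  case/maxsetP: maxK => _; apply; last exact: subsetUr.
  apply/forall_inP=> x xvK; apply/forall_inP=> y yvK; apply/implyP=> xy.
  case/setU1P: xvK yvK xy => [->|xK] /setU1P[->|yK] xy.
  - by rewrite eqxx in xy.
  - by have := av y yK; rewrite negbK adj_sym.
  - by have := av x xK; rewrite negbK.
  exact: (adjK sK xK yK xy).
have [/exists_inP[x xK xs]|] := boolP [exists x in K, x \notin nonsimplicial G].
  right; exists x; apply/esym; case/maxsetP: maxK => _; apply; last first.
    apply/subsetP=> y yK; rewrite inE; have [//|yx] := eqVneq y x.
    by apply: (adjK sK); rewrite // eq_sym.
  apply/forall_inP=> y; rewrite inE => yx; apply/forall_inP=> z; rewrite inE => zx.
  apply/implyP=> yz; case/predU1P: yx zx yz => [->|xy] /predU1P[->|xz] yz //.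
  - by rewrite eqxx in yz.
  - by rewrite adj_sym.
  apply: contraR xs => nyz; rewrite inE; apply/existsP; exists y.
  by apply/existsP; exists z; rewrite xy xz yz.
rewrite negb_exists_in => /forall_inP Kns; left; apply/setP=> x.
apply/idP/idP=> [/Kns|]; first by rewrite negbK.
rewrite inE => /existsP[y /existsP[z /and4P[xy xz yz nyz]]].
apply: contraR nyz => xK.
by apply: (adjK sK) => //; apply: (adj_outside sK xK).
Qed.

Lemma CDC_splitE (G : graph) : is_split G && is_CDC G =
  CDC_split_at (nonsimplicial G) || [exists v, CDC_split_at (@closed_nbhd G v)].
Proof.
have core (K : {set G}) : split_partition K -> inextensible K ->
    CDC_split_at K = is_CDC G.
  by move=> sK mK; rewrite /CDC_split_at sK mK (is_CDC_split sK mK).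
have sound (K : {set G}) : CDC_split_at K -> is_split G && is_CDC G.
  move=> cK; case/and4P: (cK) => sK mK _ _; rewrite -(core K sK mK) cK andbT.
  by apply/existsP; exists K.
apply/andP/orP=> [[/split_definable_clique[K [sK mK Kdef]]]|].
  rewrite -(core K sK mK) => cK; case: Kdef => [<-|[v Kv]]; first by left.
  by right; apply/existsP; exists v; rewrite -Kv.
by case=> [/sound/andP[]|/existsP[v /sound/andP[]]].
Qed.

(** * First-order formulas over graphs *)

Inductive formula : Type :=
  | Adj (x y : nat)
  | Eq (x y : nat)
  | Not (f : formula)
  | And (f g : formula)
  | All (x : nat) (f : formula).

Definition bind (T : Type) (e : nat -> T) (x : nat) (u : T) : nat -> T :=
  fun y => if y == x then u else e y.

Fixpoint eval (G : graph) (e : nat -> G) (f : formula) : bool :=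
  match f with
  | Adj x y => adj (e x) (e y)
  | Eq x y => e x == e y
  | Not f => ~~ eval e f
  | And f g => eval e f && eval e g
  | All x f => [forall u, eval (bind e x u) f]
  end.

(** The number of nested quantifiers: each of them becomes a loop over the
    vertices, so this is the exponent of the running time. *)
Fixpoint depth (f : formula) : nat :=
  match f with
  | Adj _ _ | Eq _ _ => 0
  | Not f => depth f
  | And f g => maxn (depth f) (depth g)
  | All _ f => (depth f).+1
  end.

(** Variable 0 is excluded because its registers would include the scratch
    registers; rebinding a variable in scope is excluded because the inner loop
    would destroy the counter of the outer one. *)
Fixpoint well_scoped (xs : seq nat) (f : formula) : bool :=
  match f with
  | Adj x y | Eq x y => (x \in xs) && (y \in xs)
  | Not f => well_scoped xs f
  | And f g => well_scoped xs f && well_scoped xs g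
  | All x f => [&& 0 < x, x \notin xs & well_scoped (x :: xs) f]
  end.

(** * The sentence that defines CDC split graphs *)

Definition Or f g := Not (And (Not f) (Not g)).
Definition Imp f g := Not (And f (Not g)).
Definition Ex x f := Not (All x (Not f)).

Lemma eval_All (G : graph) (e : nat -> G) x f :
  eval e (All x f) = [forall u, eval (bind e x u) f].
Proof. by []. Qed.

Lemma eval_And (G : graph) (e : nat -> G) f g :
  eval e (And f g) = eval e f && eval e g.
Proof. by []. Qed.

Lemma eval_Or (G : graph) (e : nat -> G) f g :
  eval e (Or f g) = eval e f || eval e g.
Proof. by rewrite /= negb_and !negbK. Qed.

Lemma eval_Imp (G : graph) (e : nat -> G) f g :
  eval e (Imp f g) = (eval e f ==> eval e g).
Proof. by rewrite /= negb_and negbK implybE. Qed.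

Lemma eval_Ex (G : graph) (e : nat -> G) x f :
  eval e (Ex x f) = [exists u, eval (bind e x u) f].
Proof.
by rewrite /= negb_forall; apply: eq_existsb => u; rewrite negbK.
Qed.

(** Membership in the clique is a formula [inK] in one variable. The bound
    variables below are 2 to 6; variable 1 is a parameter of [inK], and [inK]
    may bind variables from 7 on. *)
Section Relativized.

Variable inK : nat -> formula.

Definition AllIn x f := All x (Imp (inK x) f).
Definition ExIn x f := Ex x (And (inK x) f).
Definition AllOut x f := All x (Imp (Not (inK x)) f).
Definition ExOut x f := Ex x (And (Not (inK x)) f).

Definition split_formula :=
  And (AllIn 2 (AllIn 3 (Imp (Not (Eq 2 3)) (Adj 2 3))))
      (AllOut 2 (AllOut 3 (Not (Adj 2 3)))).

Definition inextensible_formula := AllOut 2 (ExIn 3 (Not (Adj 3 2))).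

Definition incomparable_formula a b :=
  And (ExOut 6 (And (Adj a 6) (Not (Adj b 6))))
      (ExOut 6 (And (Adj b 6) (Not (Adj a 6)))).

Definition private_formula :=
  AllIn 2 (AllIn 3 (Imp (incomparable_formula 2 3)
    (ExOut 4 (And (Adj 2 4)
      (AllIn 5 (Imp (incomparable_formula 2 5) (Not (Adj 5 4)))))))).

Definition misses_two_formula a b c v :=
  Or (And (Not (Adj a v)) (Not (Adj b v)))
 (Or (And (Not (Adj a v)) (Not (Adj c v)))
     (And (Not (Adj b v)) (Not (Adj c v)))).

Definition helly_formula :=
  AllIn 2 (AllIn 3 (AllIn 4 (ExIn 5
    (AllOut 6 (Imp (misses_two_formula 2 3 4 6) (Not (Adj 5 6))))))).

Definition core_formula :=
  And split_formula
 (And inextensible_formula (And private_formula helly_formula)).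

Variables (G : graph) (K : {set G}) (v0 : G).

Hypothesis eval_inK : forall e x,
  e 1 = v0 -> 1 < x < 7 -> eval e (inK x) = (e x \in K).

Lemma eval_AllIn e x f : e 1 = v0 -> 1 < x < 7 ->
  eval e (AllIn x f) = [forall u in K, eval (bind e x u) f].
Proof.
move=> e1 x17; rewrite eval_All; apply: eq_forallb => u; rewrite eval_Imp eval_inK //.
  by rewrite /bind eqxx.
by rewrite /bind ifN_eq //; case: x x17 => [|[]].
Qed.

Lemma eval_AllOut e x f : e 1 = v0 -> 1 < x < 7 ->
  eval e (AllOut x f) = [forall u, (u \notin K) ==> eval (bind e x u) f].
Proof.
move=> e1 x17; rewrite eval_All; apply: eq_forallb => u; rewrite eval_Imp /= eval_inK //.
  by rewrite /bind eqxx.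
by rewrite /bind ifN_eq //; case: x x17 => [|[]].
Qed.

Lemma eval_ExIn e x f : e 1 = v0 -> 1 < x < 7 ->
  eval e (ExIn x f) = [exists u in K, eval (bind e x u) f].
Proof.
move=> e1 x17; rewrite eval_Ex; apply: eq_existsb => u; rewrite /= eval_inK //.
  by rewrite {1}/bind eqxx.
by rewrite /bind ifN_eq //; case: x x17 => [|[]].
Qed.

Lemma eval_ExOut e x f : e 1 = v0 -> 1 < x < 7 ->
  eval e (ExOut x f) = [exists u, (u \notin K) && eval (bind e x u) f].
Proof.
move=> e1 x17; rewrite eval_Ex; apply: eq_existsb => u; rewrite /= eval_inK //.
  by rewrite {1}/bind eqxx.
by rewrite /bind ifN_eq //; case: x x17 => [|[]].
Qed.

Lemma eval_incomparable e a b : e 1 = v0 -> a < 6 -> b < 6 ->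
  eval e (incomparable_formula a b) = incomparable K (e a) (e b).
Proof.
move=> e1 a6 b6; rewrite eval_And !eval_ExOut //.
by congr (_ && _); apply: eq_existsb => u; rewrite /= /bind !(ltn_eqF a6) !(ltn_eqF b6).
Qed.

Lemma eval_core e : e 1 = v0 -> eval e core_formula = CDC_split_at K.
Proof.
move=> e1; rewrite /core_formula /split_formula !eval_And /CDC_split_at.
rewrite /split_partition; congr [&& _ && _, _, _ & _].
- rewrite eval_AllIn //; apply: eq_forallb => x; congr (_ ==> _).
  rewrite eval_AllIn //; apply: eq_forallb => y; congr (_ ==> _).
  by rewrite eval_Imp.
- rewrite eval_AllOut //; apply: eq_forallb => x; rewrite inE; congr (_ ==> _).
  by rewrite eval_AllOut //; apply: eq_forallb => y; rewrite inE.
- rewrite eval_AllOut //; apply: eq_forallb => x; congr (_ ==> _).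
  by rewrite eval_ExIn.
- rewrite eval_AllIn //; apply: eq_forallb => a; congr (_ ==> _).
  rewrite eval_AllIn //; apply: eq_forallb => b; congr (_ ==> _).
  rewrite eval_Imp eval_incomparable //; congr (_ ==> _).
  rewrite eval_ExOut //; apply: eq_existsb => v; rewrite eval_And.
  congr (_ && (_ && _)).
  rewrite eval_AllIn //; apply: eq_forallb => c; congr (_ ==> _).
  by rewrite eval_Imp eval_incomparable.
rewrite eval_AllIn //; apply: eq_forallb => a; congr (_ ==> _).
rewrite eval_AllIn //; apply: eq_forallb => b; congr (_ ==> _).
rewrite eval_AllIn //; apply: eq_forallb => c; congr (_ ==> _).
rewrite eval_ExIn //; apply: eq_existsb => d; congr (_ && _).
rewrite eval_AllOut //; apply: eq_forallb => v; congr (_ ==> _).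
by rewrite eval_Imp !eval_Or.
Qed.

End Relativized.

Definition closed_nbhd_formula x := Or (Eq x 1) (Adj 1 x).

Definition nonsimplicial_formula x :=
  Ex 7 (Ex 8 (And (Adj x 7) (And (Adj x 8) (And (Not (Eq 7 8)) (Not (Adj 7 8)))))).

Definition CDC_split_sentence : formula :=
  Or (core_formula nonsimplicial_formula)
     (Ex 1 (core_formula closed_nbhd_formula)).

(** The nested quantifiers are [a], [b], [c], [d], [v] of the Helly condition and
    the two of [nonsimplicial_formula]. *)
Lemma eval_CDC_split (G : graph) (e : nat -> G) :
  eval e CDC_split_sentence = is_split G && is_CDC G.
Proof.
rewrite eval_Or CDC_splitE; congr (_ || _).
  apply: (eval_core (v0 := e 1)) => // e' x _ /andP[_ x7].
  rewrite eval_Ex inE; apply: eq_existsb => y.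
  rewrite eval_Ex; apply: eq_existsb => z.
  by rewrite /= /bind /= !(ltn_eqF x7) !(ltn_eqF (leqW x7)).
rewrite eval_Ex; apply: eq_existsb => u.
apply: (eval_core (v0 := u)) => // e' x e'1 _.
by rewrite eval_Or inE /= e'1.
Qed.

(** * Evaluating a formula on the machine *)

(** Registers 1 and 2 are scratch; the four registers that belong to a variable
    are the block with quotient [x] in the division by 4. *)
Definition slot (x j : nat) : nat := 4 * x + j.

Notation index_reg x := (slot x 0).
(** Multiplication is not an instruction, so the address of the matrix row of
    the current vertex is kept up to date by additions. *)
Notation row_reg x := (slot x 1).
Notation verdict_reg x := (slot x 2).
Notation todo_reg x := (slot x 3).

Definition test_adj x y : program :=
  Seq (Add 1 (row_reg x) (index_reg y)) (Read 1 1).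

Definition negate : program := If 1 (Const 1 0) (Const 1 1).

Definition test_eq x y : program :=
  Seq (Defs.Sub 1 (index_reg x) (index_reg y))
 (Seq (Defs.Sub 2 (index_reg y) (index_reg x))
 (Seq (Add 1 1 2) negate)).

Definition for_all_body x p : program :=
  Seq p
 (Seq (If 1 Skip (Const (verdict_reg x) 0))
 (Seq (Const 2 1)
 (Seq (Add (index_reg x) (index_reg x) 2)
 (Seq (Add (row_reg x) (row_reg x) 0)
      (Defs.Sub (todo_reg x) (todo_reg x) 2))))).

Definition for_all x p : program :=
  Seq (Const (index_reg x) 0)
 (Seq (Const (row_reg x) 0)
 (Seq (Const (verdict_reg x) 1)
 (Seq (Add (todo_reg x) 0 (row_reg x))
 (Seq (While (todo_reg x) (for_all_body x p))
 (Seq (Const 1 0)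
      (Add 1 (verdict_reg x) 1)))))).

Fixpoint compile (f : formula) : program :=
  match f with
  | Adj x y => test_adj x y
  | Eq x y => test_eq x y
  | Not f => Seq (compile f) negate
  | And f g => Seq (compile f) (If 1 (compile g) Skip)
  | All x f => for_all x (compile f)
  end.

Fixpoint steps (f : formula) : nat :=
  match f with
  | Adj _ _ => 2
  | Eq _ _ => 5
  | Not f => steps f + 2
  | And f g => steps f + steps g + 2
  | All _ f => steps f + 14
  end.

(** The registers that code for a formula with variables in scope [xs] has to
    leave alone: the number of vertices and the blocks of these variables. *)
Definition frozen (xs : seq nat) (r : nat) : bool :=
  (r == 0) || (r %/ 4 \in xs).

Lemma slot_div x j : j < 4 -> slot x j %/ 4 = x.
Proof. by rewrite /slot; lia. Qed.

Lemma frozen_slot xs x j : x \in xs -> j < 4 -> frozen xs (slot x j).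
Proof. by move=> xin j4; rewrite /frozen slot_div // xin orbT. Qed.

Lemma frozen_sub xs x r : frozen xs r -> frozen (x :: xs) r.
Proof. by rewrite /frozen inE; case/orP=> ->; rewrite ?orbT. Qed.

Lemma frozen_scratch xs r : 0 \notin xs -> frozen xs r ->
  (r == 1 = false) * (r == 2 = false).
Proof.
move=> xs0 /orP[/eqP->//|rxs].
by split; apply: contraNF xs0 => /eqP req; rewrite req in rxs.
Qed.

Lemma frozen_neq_slot xs x r j : 0 < x -> x \notin xs -> frozen xs r -> j < 4 ->
  (r == slot x j) = false.
Proof.
move=> x0 xxs /orP[/eqP->|rxs] j4; first by rewrite /slot; lia.
by apply: contraNF xxs => /eqP req; rewrite req slot_div in rxs.
Qed.

Lemma slot_eq x i j : (slot x i == slot x j) = (i == j).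
Proof. exact: eqn_add2l. Qed.

Lemma slot_scratch x j : 0 < x -> (slot x j == 0 = false) *
  (slot x j == 1 = false) * (slot x j == 2 = false) *
  (0 == slot x j = false) * (1 == slot x j = false) * (2 == slot x j = false).
Proof. by rewrite /slot => x0; do !split; lia. Qed.

(** The rule for counted loops: [m] is the number of rounds left. *)
Lemma exec_countdown r p (inv : nat -> state -> Prop) c :
    (forall m s, reg s r = m.+1 -> inv m.+1 s ->
       exists k s', [/\ exec p s k s', k <= c, reg s' r = m & inv m s']) ->
  forall m s, reg s r = m -> inv m s ->
    exists k s', [/\ exec (While r p) s k s', k <= m * c.+1 + 1 & inv 0 s'].
Proof.
move=> body; elim=> [|m IHm] s sr si.
  by exists 1, s; split=> //; apply: exec_WhileF.
have [k1 [s1 [e1 k1c s1r s1i]]] := body m s sr si.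
have [k2 [s2 [e2 k2c s2i]]] := IHm s1 s1r s1i.
exists (k1 + k2).+1, s2; split=> //; last by lia.
by apply: exec_WhileT e1 e2; rewrite sr.
Qed.

Lemma exec_negate s : exec negate s 2 (set_reg s 1 (reg s 1 == 0)).
Proof.
by have [s1|s1] := eqVneq (reg s 1) 0; [apply: exec_IfF | apply: exec_IfT];
  rewrite ?s1 //; constructor.
Qed.

Section Correctness.

Variables (G : graph) (n : nat) (v : 'I_n -> G) (w : G -> 'I_n).
Hypotheses (vK : cancel v w) (wK : cancel w v).

Definition holds_graph (s : state) : Prop :=
  forall i j : 'I_n, Defs.mem s (i * n + j) = adj (v i) (v j).

Definition holds_env (xs : seq nat) (e : nat -> G) (s : state) : Prop :=
  forall x, x \in xs ->
    reg s (index_reg x) = w (e x) /\ reg s (row_reg x) = w (e x) * n.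

Lemma holds_env_frozen xs e s s' :
    (forall r, frozen xs r -> reg s' r = reg s r) ->
  holds_env xs e s -> holds_env xs e s'.
Proof.
move=> fr he x xin; have [<- <-] := he x xin.
by split; apply/fr/frozen_slot.
Qed.

Lemma holds_env_bind xs e s x u : x \notin xs ->
    reg s (index_reg x) = w u -> reg s (row_reg x) = w u * n ->
  holds_env xs e s -> holds_env (x :: xs) (bind e x u) s.
Proof.
move=> xxs si sr he y; rewrite inE /bind; have [->|_ /=] := eqVneq y x => //.
exact: he.
Qed.

(** The contract under which code for subformulas is composed: within [c] steps
    the truth value goes to register 1, and the graph, the number of vertices
    and the variables in scope survive. *)
Definition computes (xs : seq nat) (p : program) (b : (nat -> G) -> bool)
    (c : nat) : Prop :=
  forall e s, reg s 0 = n -> holds_graph s -> holds_env xs e s ->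
  exists k s', [/\ exec p s k s', k <= c, reg s' 1 = b e :> nat,
    Defs.mem s' = Defs.mem s & forall r, frozen xs r -> reg s' r = reg s r].

Lemma computes_le xs p b c c' : c <= c' ->
  computes xs p b c -> computes xs p b c'.
Proof.
move=> cc' hp e s s0 sg he; have [k [s' [ex kc s'1 s'm fr]]] := hp e s s0 sg he.
by exists k, s'; split=> //; apply: leq_trans cc'.
Qed.

Lemma computes_and xs p q b b' c c' : computes xs p b c -> computes xs q b' c' ->
  computes xs (Seq p (If 1 q Skip)) (fun e => b e && b' e) (c + c' + 2).
Proof.
move=> hp hq e s s0 sg he; have [k [s1 [ex kc s11 s1m fr1]]] := hp e s s0 sg he.
case: (b e) s11 => /= s11; last first.
  exists (k + 2), s1; split=> //; last by lia.
  by apply: exec_Seq ex _; apply: exec_IfF => //; constructor.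
have [|||k2 [s2 [ex2 kc2 s21 s2m fr2]]] := hq e s1.
- by rewrite fr1.
- by move=> i j; rewrite s1m.
- exact: holds_env_frozen fr1 he.
exists (k + k2.+1), s2; split=> //.
- by apply: exec_Seq ex _; apply: exec_IfT => //; rewrite s11.
- by lia.
- by rewrite s2m.
- by move=> r frr; rewrite fr2 // fr1.
Qed.

Section Scope.

Variable xs : seq nat.
Hypothesis xs0 : 0 \notin xs.

Lemma computes_adj x y : x \in xs -> y \in xs ->
  computes xs (test_adj x y) (fun e => adj (e x) (e y)) 2.
Proof.
move=> xx yx e s s0 sg he; do 2 eexists; split.
- by apply: exec_Seq; constructor.
- by [].
- by have [[_ xr] [yi _]] := (he x xx, he y yx); rewrite /= /update /= xr yi sg !wK.
- by [].
- by move=> r fr; rewrite /= /update !(frozen_scratch xs0 fr).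
Qed.

Lemma computes_eq x y : x \in xs -> y \in xs ->
  computes xs (test_eq x y) (fun e => e x == e y) 5.
Proof.
move=> xx yx e s s0 sg he; have [[xi _] [yi _]] := (he x xx, he y yx).
have x1 := (frozen_scratch xs0 (frozen_slot (j := 0) xx isT)).1.
have y1 := (frozen_scratch xs0 (frozen_slot (j := 0) yx isT)).1.
do 2 eexists; split.
- do 3 (apply: exec_Seq; first by constructor).
  exact: exec_negate.
- by [].
- (* both truncated differences vanish exactly when the indices agree *)
  rewrite /= /update /= x1 y1 xi yi addn_eq0 !subn_eq0 -eqn_leq.
  by rewrite val_eqE (can_eq wK).
- by [].
- by move=> r fr; rewrite /= /update !(frozen_scratch xs0 fr).
Qed.

Lemma computes_not p b c : computes xs p b c ->
  computes xs (Seq p negate) (fun e => ~~ b e) (c + 2).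
Proof.
move=> hp e s s0 sg he; have [k [s' [ex kc s'1 s'm fr]]] := hp e s s0 sg he.
exists (k + 2), (set_reg s' 1 (reg s' 1 == 0)); split.
- exact: exec_Seq ex (exec_negate s').
- by rewrite leq_add2r.
- by rewrite /= /update /= s'1 eqb0.
- by [].
- by move=> r frr; rewrite /= /update (frozen_scratch xs0 frr) fr.
Qed.

Section Loop.

Variables (x : nat) (p : program) (b : (nat -> G) -> bool) (c : nat).
Hypotheses (x0 : 0 < x) (xxs : x \notin xs).
Hypothesis hp : computes (x :: xs) p b c.
Variables (e : nat -> G) (s : state).
Hypotheses (s0 : reg s 0 = n) (sg : holds_graph s) (he : holds_env xs e s).

(** The verdict after the first [j] vertices. *)
Definition all_before (j : nat) : bool :=
  [forall i : 'I_n, (i < j) ==> b (bind e x (v i))].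

Lemma all_beforeS (i : 'I_n) :
  all_before i.+1 = all_before i && b (bind e x (v i)).
Proof.
apply/forallP/andP=> [all|[/forallP all bi] i'].
  split; last by have /implyP := all i; apply.
  by apply/forallP=> i'; apply/implyP=> lt; have /implyP := all i'; apply; apply: ltnW.
apply/implyP; rewrite ltnS leq_eqVlt => /predU1P[/val_inj-> //|lt].
by have /implyP := all i'; apply.
Qed.

Lemma all_before_n : all_before n = [forall u, b (bind e x u)].
Proof.
apply/forallP/forallP=> all u; last exact/implyP.
by have /implyP := all (w u); rewrite wK; apply.
Qed.

(** The state with [m] vertices left to visit, [s] being the state in which the
    loop was entered. *)
Definition loop_inv (m : nat) (t : state) : Prop :=
  [/\ m <= n, reg t (index_reg x) = n - m, reg t (row_reg x) = (n - m) * n,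
      reg t (verdict_reg x) = all_before (n - m) :> nat
    & Defs.mem t = Defs.mem s /\ forall r, frozen xs r -> reg t r = reg s r].

Lemma loop_step m t : reg t (todo_reg x) = m.+1 -> loop_inv m.+1 t ->
  exists k t', [/\ exec (for_all_body x p) t k t', k <= c + 6,
                  reg t' (todo_reg x) = m & loop_inv m t'].
Proof.
move=> tm [mn ti tr tv [tmem tfr]].
have im : n - m.+1 < n by rewrite ltn_subrL (leq_ltn_trans _ mn).
pose i := Ordinal im; have iS : n - m = i.+1 by rewrite /= subnSK.
have [|||k [t1 [ex kc t11 t1m t1fr]]] := hp (e := bind e x (v i)) (s := t).
- by rewrite tfr.
- by move=> i1 j1; rewrite tmem.
- apply: holds_env_bind; rewrite ?vK //.
  exact: holds_env_frozen tfr he.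
have t1x j : j < 4 -> reg t1 (slot x j) = reg t (slot x j).
  by move=> j4; apply/t1fr/frozen_slot; rewrite // mem_head.
pose t2 := if b (bind e x (v i)) then t1 else set_reg t1 (verdict_reg x) 0.
have ex2 : exec (If 1 Skip (Const (verdict_reg x) 0)) t1 2 t2.
  rewrite /t2; case: (b _) t11 => t11; [apply: exec_IfT | apply: exec_IfF];
    by rewrite ?t11 //; constructor.
have t2v : reg t2 (verdict_reg x) = all_before i.+1 :> nat.
  rewrite all_beforeS /t2; case: (b _); last by rewrite andbF /= /update eqxx.
  by rewrite andbT t1x // tv.
have t2r r : r != verdict_reg x -> reg t2 r = reg t1 r.
  by move=> rv; rewrite /t2; case: (b _); rewrite //= /update ifN.
have t2m : Defs.mem t2 = Defs.mem s by rewrite -tmem -t1m /t2; case: (b _).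
have t2x j : j < 4 -> j != 2 -> reg t2 (slot x j) = reg t (slot x j).
  by move=> j4 j2; rewrite t2r ?slot_eq ?t1x.
have t2fr r : frozen xs r -> reg t2 r = reg s r.
  move=> fr; rewrite t2r ?(frozen_neq_slot x0 xxs fr) //.
  by rewrite t1fr ?tfr //; apply: frozen_sub.
have x012 := slot_scratch _ x0.
do 2 eexists; split.
- apply: exec_Seq ex _; apply: exec_Seq ex2 _.
  do 3 (apply: exec_Seq; first by constructor).
  by constructor.
- by rewrite leq_add2r.
- by rewrite /= /update /= ?slot_eq ?x012 /= t2x // tm subn1.
rewrite /loop_inv iS; split.
- exact: ltnW.
- by rewrite /= /update /= ?slot_eq ?x012 /= t2x // ti addn1.
- by rewrite /= /update /= ?slot_eq ?x012 /= t2x // tr t2fr // s0 mulSn addnC.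
- by rewrite /= /update /= ?slot_eq ?x012 /= t2v.
split=> // r fr; rewrite /= /update !(frozen_neq_slot x0 xxs fr) //.
by rewrite (frozen_scratch xs0 fr) t2fr.
Qed.

Lemma exec_for_all : exists k s', [/\ exec (for_all x p) s k s',
    k <= n * (c + 7) + 7, reg s' 1 = [forall u, b (bind e x u)] :> nat,
    Defs.mem s' = Defs.mem s & forall r, frozen xs r -> reg s' r = reg s r].
Proof.
have x012 := slot_scratch _ x0.
pose s1 := set_reg (set_reg (set_reg s (index_reg x) 0) (row_reg x) 0)
             (verdict_reg x) 1.
pose s2 := set_reg s1 (todo_reg x) (reg s1 0 + reg s1 (row_reg x)).
have s2todo : reg s2 (todo_reg x) = n.
  by rewrite /= /update /= ?slot_eq ?x012 /= s0 addn0.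
have inv2 : loop_inv n s2.
  split; rewrite ?subnn //= /update /= ?slot_eq ?x012 //=.
    by apply/esym/eqP; rewrite eqb1; apply/forallP.
  by split=> // r fr; rewrite !(frozen_neq_slot x0 xxs fr).
have [k [s3 [ex kc [_ _ _ s3v [s3m s3fr]]]]] := exec_countdown loop_step s2todo inv2.
do 2 eexists; split.
- do 4 (apply: exec_Seq; first by constructor).
  apply: exec_Seq ex _; by apply: exec_Seq; constructor.
- by move: kc; rewrite addnS; lia.
- by rewrite /= /update /= ?x012 addn0 s3v subn0 all_before_n.
- by [].
- by move=> r fr; rewrite /= /update (frozen_scratch xs0 fr) s3fr.
Qed.

End Loop.

Lemma computes_for_all x p b c : 0 < x -> x \notin xs -> computes (x :: xs) p b c ->
  computes xs (for_all x p) (fun e => [forall u, b (bind e x u)]) (n * (c + 7) + 7).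
Proof. by move=> x0 xxs hp e s s0 sg he; apply: exec_for_all. Qed.

End Scope.

Hypothesis n0 : 0 < n.

(** A quantifier multiplies the time by [n], up to the constant that [steps]
    collects. *)
Lemma compile_computes f xs : 0 \notin xs -> well_scoped xs f ->
  computes xs (compile f) (fun e => eval e f) (steps f * n ^ depth f).
Proof.
elim: f xs => [x y|x y|f IHf|f IHf g IHg|x f IHf] xs xs0 /=.
- by case/andP=> xx yx; apply: computes_adj.
- by case/andP=> xx yx; apply: computes_eq.
- move=> wf; apply: (computes_le _ (computes_not xs0 (IHf xs xs0 wf))).
  by rewrite mulnDl leq_add2l leq_pmulr // expn_gt0 n0.
- case/andP=> wf wg.
  apply: (computes_le _ (computes_and (IHf xs xs0 wf) (IHg xs xs0 wg))).
  rewrite !mulnDl !leq_add ?leq_pmulr ?expn_gt0 ?n0 //.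
    by rewrite leq_mul // leq_pexp2l // leq_maxl.
  by rewrite leq_mul // leq_pexp2l // leq_maxr.
case/and3P=> x0 xxs wf.
have x0s : 0 \notin x :: xs by rewrite inE negb_or xs0 eq_sym -lt0n x0.
apply: (computes_le _ (computes_for_all xs0 x0 xxs (IHf _ x0s wf))).
have : 0 < n ^ depth f by rewrite expn_gt0 n0.
rewrite expnS; move: (n ^ depth f) => N; nia.
Qed.

End Correctness.

(** Matrix addresses determine row and column by division with remainder. *)
Lemma mem_input (G : graph) (v : 'I_#|G| -> G) : holds_graph v (input v).
Proof.
move=> i j; congr nat_of_bool; apply/existsP/idP => [[i' /existsP[j']]|aij]; last first.
  by exists i; apply/existsP; exists j; rewrite eqxx.
case/andP=> /eqP eqij; suff [-> ->] : i = i' /\ j = j' by [].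
have n0 := vertex_gt0 G.
split; apply: val_inj => /=.
  by have := congr1 (divn^~ #|G|) eqij; rewrite !divnMDl // !divn_small // !addn0.
by have := congr1 (modn^~ #|G|) eqij; rewrite !modnMDl !modn_small.
Qed.

(** * The decision procedure *)

Theorem corollary7p7 :
  exists (p : program) (t : nat -> nat),
    bigO t (fun n : nat => n ^ 8) /\
    decides_in_time p (fun G : graph => is_split G && is_CDC G) t.
Proof.
pose F := CDC_split_sentence.
exists (Seq (compile F) (Seq (Const 2 0) (Add 0 1 2))).
exists (fun n => steps F * n ^ depth F + 2); split.
  exists (steps F + 2), 1 => n n0; rewrite mulnDl leq_add //.
    (* [depth F] computes to 7 *)
    by rewrite leq_mul // leq_pexp2l.
  by rewrite leq_pmulr // expn_gt0 n0.
move=> G v [w vK wK]; have n0 := vertex_gt0 G.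
have /card_gt0P[u _] := n0; have hF : well_scoped [::] F by [].
have [||||k [s [ex kle s1 _ _]]] :=
  compile_computes vK wK n0 _ hF (e := fun=> u) (s := input v).
- by [].
- by [].
- exact: mem_input.
- by [].
exists (k + 2), (set_reg (set_reg s 2 0) 0 (reg s 1 + 0)); split.
- by apply: exec_Seq ex _; apply: (@exec_Seq _ _ _ _ _ 1 1); constructor.
- by rewrite leq_add2r.
by rewrite /= /update /= addn0 s1 eval_CDC_split.
Qed.
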